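(* There exists a graph $G$ having a mitigating set $S\subseteq E(G)$ of size $|S|=\mathrm{es}_{\chi'}(G)$ and an edge $uv\in S$ which does not satisfy $\max\{d_G(u),d_G(v)\}\geq \Delta(G)-1$, i.e. such that $\max\{d_G(u),d_G(v)\}<\Delta(G)-1$.
   Context: All graphs are finite, simple (no loops or multiple edges) and have at least one edge. $d_G(v)$ denotes the degree of $v$ in $G$ and $\Delta(G)$ the maximum degree of $G$. The chromatic index $\chi'(G)$ is the minimum number of colors in a proper edge coloring of $G$ (incident edges receive different colors); an edgeless graph, which may arise after deleting edges, has chromatic index $0$. A mitigating set of $G$ is a set of edges $F\subseteq E(G)$ such that $\chi'(G\setminus F)<\chi'(G)$, where $G\setminus F$ is obtained by deleting the edges of $F$ and keeping all vertices. The chromatic edge stability index $\mathrm{es}_{\chi'}(G)$ is the minimum number of edges of $G$ whose removal results in a graph $H$ with $\chi'(H)=\chi'(G)-1$; equivalently, the minimum size of a mitigating set of $G$. *)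

(* Defs.v *)
From mathcomp Require Import all_boot.

Set Implicit Arguments.
Unset Strict Implicit.
Unset Printing Implicit Defensive.

Record sgraph := SGraph {
  vertex :> finType;
  adj : rel vertex;
  adj_sym : symmetric adj;
  adj_irrefl : irreflexive adj
}.

Section SimpleGraph.
Variable G : sgraph.

(* An edge is identified with the set of its two (distinct) ends. *)
Definition edges : {set {set G}} :=
  [set [set p.1; p.2] | p : G * G & adj p.1 p.2].

Definition deg (v : G) : nat := #|[set w | adj v w]|.

Definition max_deg : nat := \max_(v : G) deg v.

(* G \ F: all vertices are kept; elements of F that are not edges are
   irrelevant. *)
Definition del_rel (F : {set {set G}}) : rel G :=
  fun x y => adj x y && ([set x; y] \notin F).

Lemma del_sym F : symmetric (del_rel F).
Proof. by move=> x y; rewrite /del_rel adj_sym setUC. Qed.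

Lemma del_irrefl F : irreflexive (del_rel F).
Proof. by move=> x; rewrite /del_rel adj_irrefl. Qed.

Definition del_edges (F : {set {set G}}) : sgraph :=
  SGraph (del_sym F) (del_irrefl F).

(* Colorings are defined on edges only, so that an edgeless graph has a
   coloring with 0 colors. *)
Definition edge : finType := {e : {set G} | e \in edges}.

Definition incident (e f : edge) : bool :=
  (e != f) && (val e :&: val f != set0).

Definition proper_edge_coloring k (c : {ffun edge -> 'I_k}) : bool :=
  [forall e, forall f, incident e f ==> (c e != c f)].

Definition edge_colorable (k : nat) : bool :=
  [exists c : {ffun edge -> 'I_k}, proper_edge_coloring c].

Lemma edge_colorable_exists : exists k, edge_colorable k.
Proof.
exists #|edge|; apply/existsP; exists [ffun e => enum_rank e].
apply/forallP=> e; apply/forallP=> f; apply/implyP=> /andP[ef _].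
by rewrite !ffunE (inj_eq enum_rank_inj).
Qed.

Definition chromatic_index : nat := ex_minn edge_colorable_exists.

End SimpleGraph.

Definition mitigating (G : sgraph) (F : {set {set G}}) : bool :=
  (F \subset edges G) &&
  (chromatic_index (del_edges F) < chromatic_index G).

Lemma edgesP (G : sgraph) (e : {set G}) :
  reflect (exists x y, adj x y /\ e = [set x; y]) (e \in edges G).
Proof.
apply: (iffP imsetP) => [[[x y] xy ->]|[x [y [xy ->]]]].
  by exists x, y; rewrite inE in xy.
by exists (x, y); rewrite ?inE.
Qed.

Lemma edges_del (G : sgraph) (F : {set {set G}}) :
  edges (del_edges F) = edges G :\: F.
Proof.
apply/setP=> e; rewrite !inE; apply/edgesP/andP.
  by case=> x [y [/andP[xy nF] ->]]; split=> //; apply/edgesP; exists x, y.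
case=> nF /edgesP[x [y [xy De]]]; exists x, y; split=> //.
by rewrite /= /del_rel xy -De.
Qed.

Lemma edge_colorableP (G : sgraph) k :
  reflect (exists c : {set G} -> nat,
             {in edges G, forall e, c e < k} /\
             {in edges G &, forall e f,
                e != f -> e :&: f != set0 -> c e != c f})
          (edge_colorable G k).
Proof.
apply: (iffP existsP) => [[c /forallP cP]|[c [ck cP]]].
  exists (fun e => if insub e is Some e' then nat_of_ord (c e') else 0).
  split=> [e eE|e f eE fE ef ief]; first by rewrite insubT.
  rewrite !insubT; have /forallP/(_ (Sub f fE))/implyP := cP (Sub e eE).
  by apply; rewrite /incident -(inj_eq val_inj) ef.
exists [ffun e : edge G => Ordinal (ck _ (valP e))].
apply/forallP=> e; apply/forallP=> f; apply/implyP=> /andP[ef ief].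
rewrite !ffunE -(inj_eq val_inj) /=; apply: cP ief; rewrite ?(valP e) ?(valP f) //.
Qed.

Lemma chromatic_indexP (G : sgraph) k :
  edge_colorable G k -> chromatic_index G <= k.
Proof. by rewrite /chromatic_index; case: ex_minnP => m _; apply. Qed.

Lemma chromatic_index_colorable (G : sgraph) :
  edge_colorable G (chromatic_index G).
Proof. by rewrite /chromatic_index; case: ex_minnP. Qed.

(* Deleting one color class of an optimal coloring lowers the chromatic index
   by exactly one. *)
Lemma es_exists (G : sgraph) :
  exists n, [exists F : {set {set G}},
    [&& F \subset edges G,
        chromatic_index (del_edges F) == chromatic_index G - 1 & #|F| == n]].
Proof.
have /edge_colorableP[c [ck cP]] := chromatic_index_colorable G.
set k := chromatic_index G in ck *.
pose F := [set e in edges G | c e == k.-1].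
exists #|F|; apply/existsP; exists F; rewrite eqxx andbT.
apply/andP; split; first by apply/subsetP=> e; rewrite inE => /andP[].
rewrite eqn_leq subn1; apply/andP; split.
  apply/chromatic_indexP/edge_colorableP; exists c; rewrite edges_del.
  split=> [e|e f]; rewrite !inE.
    case/andP=> /[swap] eE; rewrite eE /= => nk.
    rewrite ltn_neqAle nk /=; have := ck e eE.
    by case: (k).
  by case/andP=> _ eE /andP[_ fE]; apply: cP.
have /edge_colorableP[d [dk dP]] := chromatic_index_colorable (del_edges F).
set l := chromatic_index _ in dk *.
suff: k <= l.+1 by case: (k).
apply/chromatic_indexP/edge_colorableP.
rewrite edges_del in dk dP.
exists (fun e => if e \in F then l else d e); split=> [e eE|e f eE fE ef ief].
  case: ifPn => // nF; apply/ltnW; rewrite ltnS; apply: dk.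
  by rewrite inE nF.
case: ifPn => eF; case: ifPn => fF.
- have := cP e f eE fE ef ief; move: eF fF; rewrite !inE eE fE /=.
  by move=> /eqP-> /eqP->; rewrite eqxx.
- by rewrite eq_sym neq_ltn dk // inE fF.
- by rewrite neq_ltn dk // inE eF.
- by apply: dP; rewrite // inE ?eF ?fF.
Qed.

(* Only meaningful when G has an edge; with truncated subtraction the value
   at an edgeless graph is 0. *)
Definition es_index (G : sgraph) : nat := ex_minn (es_exists G).

(* Main.v *)
Require Import Defs.
From mathcomp Require Import all_boot.
From mathcomp Require Import all_algebra.

(** The idea is to find a graph that fails to be Delta-edge-colorable only
    because it has one edge too many, and in which this can be blamed on an
    edge between two vertices of small degree.

    Color classes are matchings, so a graph on an odd number n of vertices
    with more than Delta * (n - 1)/2 edges is not Delta-edge-colorable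
    ([edges_le_colors_half]).  Start from K_8 minus a perfect matching,
    K_{2,2,2,2}, which is 6-regular and decomposes into 6 perfect matchings.
    Split one of its vertices into two vertices u and v, each receiving three
    of the six neighbors.  The 6-coloring survives the splitting, so the new
    graph is 6-edge-colorable; it has 9 vertices and 24 = 6 * 4 edges, as many
    as six matchings on 9 vertices can have.  Adding the edge uv thus forces a
    seventh color.  In the resulting graph, [split_graph], the maximum degree is 6,
    both u and v have degree 3 + 1 = 4 < 6 - 1, and the single edge uv is a
    mitigating set.  A mitigating set of one edge is automatically minimum
    ([es_index_mitigating1]).

    The 6-coloring is the classical one-factorization of K_8 on Z/7 with a
    point at infinity: the edge ab has color a + b, the edge joining a to
    infinity has color 2a.  The matching that is left out is the class of
    color 0, and infinity is the vertex that is split. *)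

Set Implicit Arguments.
Unset Strict Implicit.
Unset Printing Implicit Defensive.

(** * Counting and coloring edges *)

Section EdgeCounting.
Variable G : sgraph.

Lemma card_edge (e : {set G}) : e \in edges G -> #|e| = 2.
Proof.
case/edgesP=> x [y [xy ->]]; rewrite cards2.
by case: eqVneq xy => [->|//]; rewrite adj_irrefl.
Qed.

Lemma deg_edges (v : G) : deg v = #|[set e in edges G | v \in e]|.
Proof.
have vinj : {in [set w | adj v w] &, injective (fun w => [set v; w])}.
  move=> w w'; rewrite !inE => vw vw' E.
  have : w \in [set v; w'] by rewrite -E !inE eqxx orbT.
  by rewrite !inE => /orP[] /eqP // D; rewrite D adj_irrefl in vw.
rewrite /deg -(card_in_imset vinj); apply: eq_card => e.
apply/imsetP/idP => [[w]|].
  rewrite inE => vw ->; rewrite !inE eqxx andbT.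
  by apply/edgesP; exists v, w.
rewrite inE => /andP[/edgesP[x [y [xy ->]]]].
rewrite !inE => /orP[] /eqP ->; first by exists y; rewrite ?inE.
by exists x; rewrite ?inE 1?adj_sym // setUC.
Qed.

Lemma sum_deg : \sum_(v : G) deg v = #|edges G| * 2.
Proof.
under eq_bigr => v _ do rewrite deg_edges -sum1dep_card big_mkcondr /=.
rewrite exchange_big /= -sum_nat_const; apply: eq_bigr => e /card_edge <-.
by rewrite -big_mkcond sum1_card.
Qed.

(** A color class is a matching, and the 2-element sets of a matching are
    disjoint, so it has at most half as many edges as there are vertices. *)
Lemma edges_le_colors_half k :
  edge_colorable G k -> #|edges G| <= k * #|G|./2.
Proof.
case/edge_colorableP=> c [ck cP].
have class_small (i : 'I_k) : #|[set e in edges G | c e == i]| <= #|G|./2.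
  set M := [set e in _ | _].
  have Mtriv : trivIset M.
    apply/trivIsetP=> e f; rewrite !inE => /andP[eE /eqP ei] /andP[fE /eqP fi].
    move=> ef; rewrite -setI_eq0; apply/negPn/negP => /(cP e f eE fE ef).
    by rewrite ei fi eqxx.
  rewrite geq_half_double -muln2 -sum_nat_const.
  rewrite (eq_bigr (fun e : {set G} => #|e|)) ?(eqP Mtriv) ?max_card // => e.
  by rewrite inE => /andP[/card_edge].
have one_color e : e \in edges G -> \sum_(i < k | c e == i) 1 = 1.
  by move=> /ck ek; rewrite (big_pred1 (Ordinal ek)) // => i; rewrite eq_sym.
rewrite -sum1_card -(eq_bigr _ one_color).
rewrite (exchange_big_dep predT) //= -[k in k * _]card_ord -sum_nat_const.
by apply: leq_sum => i _; rewrite sum1dep_card class_small.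
Qed.

Lemma edge_colorable_mono k l :
  k <= l -> edge_colorable G k -> edge_colorable G l.
Proof.
move=> kl /edge_colorableP[c [ck cP]]; apply/edge_colorableP; exists c.
by split=> // e /ck ek; apply: leq_trans ek kl.
Qed.

(** Colorings of graphs whose vertices have names are easier to give, and to
    check, on ordered pairs of vertices than on sets. *)
Lemma edge_colorable_adj k (c : G -> G -> nat) :
    (forall x y, c x y = c y x) ->
    (forall x y, adj x y -> c x y < k) ->
    (forall x y z, adj x y -> adj x z -> c x y = c x z -> y = z) ->
  edge_colorable G k.
Proof.
move=> cC ck cP; apply/edge_colorableP.
pose ends (e : {set G}) := [pick p : G * G | e == [set p.1; p.2]].
pose d e := if ends e is Some p then c p.1 p.2 else 0.
have dE x y : d [set x; y] = c x y.
  rewrite /d /ends; case: pickP => [[x' y'] /= /eqP E|/(_ (x, y))]; last first.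
    by rewrite /= eqxx.
  have : x' \in [set x; y] by rewrite E !inE eqxx.
  have : y' \in [set x; y] by rewrite E !inE eqxx orbT.
  have : x \in [set x'; y'] by rewrite -E !inE eqxx.
  have : y \in [set x'; y'] by rewrite -E !inE eqxx orbT.
  rewrite !inE => /orP[]/eqP Dy /orP[]/eqP Dx; rewrite Dy Dx ?eqxx ?orbb //.
    by move=> /eqP->.
  by move=> _ /eqP->.
exists d; split=> [e /edgesP[x [y [xy ->]]]|]; first by rewrite dE ck.
move=> e f eE fE ef /set0Pn[x]; rewrite inE => /andP[xe xf].
have at_x g : g \in edges G -> x \in g -> exists2 y, adj x y & g = [set x; y].
  case/edgesP=> [y [z [yz ->]]]; rewrite !inE => /orP[]/eqP->.
    by exists z.
  by exists y; rewrite 1?adj_sym // setUC.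
have [y xy De] := at_x e eE xe; have [z xz Df] := at_x f fE xf.
apply: contra ef => /eqP; rewrite De Df !dE => /(cP x y z xy xz) ->.
by [].
Qed.

Lemma chromatic_index_del1 (e : {set G}) :
  chromatic_index G <= (chromatic_index (del_edges [set e])).+1.
Proof.
have /edge_colorableP[d [dk dP]] := chromatic_index_colorable (del_edges [set e]).
set l := chromatic_index _ in dk *.
apply/chromatic_indexP/edge_colorableP; rewrite edges_del in dk dP.
have mem f : f \in edges G -> f != e -> f \in edges G :\: [set e].
  by rewrite !inE => -> ->.
exists (fun f => if f == e then l else d f).
split=> [f fE|f g fE gE fg ifg].
  by case: ifPn => // fe; rewrite ltnS ltnW // dk // mem.
case: (eqVneq f e) (eqVneq g e) => [fe|fe] [ge|ge].
- by rewrite fe ge eqxx in fg.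
- by rewrite neq_ltn dk ?orbT // mem.
- by rewrite neq_ltn dk // mem.
- by apply: dP; rewrite // mem.
Qed.

(** The stability index asks for a drop of the chromatic index by exactly one,
    which for a single edge follows from any drop: the deleted edge can always
    be given a color of its own. *)
Lemma es_index_mitigating1 (e : {set G}) : mitigating [set e] -> es_index G = 1.
Proof.
case/andP=> eE lt_e; apply/eqP; rewrite eqn_leq /es_index.
case: ex_minnP => n /existsP[F /and3P[_ /eqP chiF /eqP cardF]] nmin.
apply/andP; split.
  apply: nmin; apply/existsP; exists [set e]; rewrite eE cards1 eqxx andbT /=.
  rewrite subn1 eqn_leq -ltnS (ltn_predK lt_e) lt_e /=.
  by rewrite -ltnS (ltn_predK lt_e) chromatic_index_del1.
(* Deleting no edge does not change the chromatic index, which is positive. *)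
rewrite lt0n; apply/eqP => n0; move: cardF; rewrite n0 => /eqP.
rewrite cards_eq0 => /eqP F0.
have : chromatic_index G <= chromatic_index (del_edges F).
  apply/chromatic_indexP/edge_colorableP.
  have /edge_colorableP := chromatic_index_colorable (del_edges F).
  by rewrite edges_del F0 setD0.
rewrite chiF subn1 => le_pred.
by move: lt_e le_pred; case: (chromatic_index G) => // m _; rewrite ltnn.
Qed.

End EdgeCounting.

(** * Splitting a vertex of K_{2,2,2,2} *)

(** The two copies of the point at infinity are [inr true], which receives
    the neighbors 1, 2, 3, and [inr false], which receives 4, 5, 6. *)
Definition split_adj (x y : 'Z_7 + bool) : bool :=
  match x, y with
  | inl a, inl b => (a != b) && (a + b != 0)%R
  | inl a, inr t | inr t, inl a => (a != 0%R) && (t == (a < 4))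
  | inr s, inr t => s != t
  end.

Lemma split_adj_sym : symmetric split_adj.
Proof. by move=> [a|s] [b|t] //=; rewrite eq_sym // GRing.addrC. Qed.

Lemma split_adj_irrefl : irreflexive split_adj.
Proof. by move=> [a|s] /=; rewrite eqxx. Qed.

Definition split_graph : sgraph := SGraph split_adj_sym split_adj_irrefl.

Definition split_edge : {set split_graph} := [set inr true; inr false].

Lemma split_edge_mem : split_edge \in edges split_graph.
Proof. by apply/edgesP; exists (inr true), (inr false). Qed.

Lemma deg_split (v : split_graph) : deg v = if v is inl _ then 6 else 4.
Proof.
rewrite /deg -sum1dep_card big_mkcond big_sumType big_bool /=.
case: v => [[a lt_a]|[]] /=; rewrite !big_ord_recl big_ord0 //.
by move: a lt_a; do 7?[case=> //].
Qed.

Lemma split_graph_not_6_colorable : ~~ edge_colorable split_graph 6.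
Proof.
have card_edges : #|edges split_graph| * 2 = 25 * 2.
  rewrite -sum_deg (eq_bigr _ (fun v _ => deg_split v)) big_sumType /=.
  by rewrite !sum_nat_const card_ord card_bool.
(* There are 25 edges, but six matchings on 9 vertices have at most 24. *)
apply/negP => /edges_le_colors_half; rewrite card_sum card_ord card_bool.
by rewrite -(leq_pmul2r (isT : 0 < 2)) card_edges.
Qed.

(** The one-factorization of K_8 on Z/7 and infinity, without its class of
    color 0; both copies of infinity use the same formula.  The value at a pair
    of copies is only filled in: their edge is to be deleted. *)
Definition sum_color (x y : 'Z_7 + bool) : 'Z_7 :=
  match x, y with
  | inl a, inl b => a + b
  | inl a, inr _ | inr _, inl a => a + a
  | inr _, inr _ => 0
  end%R.

Lemma sum_colorC x y : sum_color x y = sum_color y x.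
Proof. by case: x y => [a|s] [b|t] //=; rewrite GRing.addrC. Qed.

Lemma double_Z7_eq0 (a : 'Z_7) : (a + a == 0)%R = (a == 0%R).
Proof. by case: a; do 7?[case=> //]. Qed.

(** Makes the edges at a copy of infinity have different colors. *)
Lemma double_Z7_inj : injective (fun a : 'Z_7 => a + a)%R.
Proof.
move=> a b /eqP; rewrite -GRing.subr_eq0 GRing.opprD GRing.addrACA.
by rewrite double_Z7_eq0 GRing.subr_eq0 => /eqP.
Qed.

Lemma split_graph_del_6_colorable :
  edge_colorable (del_edges [set split_edge]) 6.
Proof.
have not_split s t : [set inr s; inr t] \notin [set split_edge] -> s = t.
  by case: s t => [] [] //; rewrite inE ?[[set inr false; _]]setUC eqxx.
have color_neq0 x y : del_rel [set split_edge] x y -> sum_color x y != 0%R.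
  case/andP; case: x y => [a|s] [b|t] /=.
  - by case/andP.
  - by rewrite double_Z7_eq0 => /andP[].
  - by rewrite double_Z7_eq0 => /andP[].
  - by move=> st /not_split E; rewrite E eqxx in st.
(* Color 0 does not occur, so that the predecessors are the colors 0 to 5. *)
apply: (@edge_colorable_adj (del_edges [set split_edge]) 6 (fun x y => (sum_color x y).-1)).
- by move=> x y; rewrite sum_colorC.
- move=> x y /color_neq0; rewrite -(inj_eq val_inj) /= -lt0n => pos.
  by rewrite -ltnS prednK // ltn_ord.
move=> x y z xy xz E.
have {E} : sum_color x y = sum_color x z.
  apply: val_inj; move: (color_neq0 _ _ xy) (color_neq0 _ _ xz).
  rewrite -!(inj_eq val_inj) /= -!lt0n => y0 z0.
  by rewrite -(prednK y0) E prednK.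
case/andP: xy => xy Sxy; case/andP: xz => xz Sxz.
case: x y z xy xz Sxy Sxz => [a|s] [b|t] [c|r] /= xy xz Sxy Sxz.
- by move/GRing.addrI->.
- by case/andP: xy => /negP ab _ /GRing.addrI E; rewrite E eqxx in ab.
- by case/andP: xz => /negP ac _ /GRing.addrI E; rewrite E eqxx in ac.
- by case/andP: xy => _ /eqP->; case/andP: xz => _ /eqP->.
- by move/double_Z7_inj->.
- by rewrite (not_split _ _ Sxz) eqxx in xz.
- by rewrite (not_split _ _ Sxy) eqxx in xy.
- by rewrite (not_split _ _ Sxy) eqxx in xy.
Qed.

Lemma mitigating_split_edge : mitigating [set split_edge].
Proof.
rewrite /mitigating sub1set split_edge_mem /=.
apply: leq_ltn_trans (chromatic_indexP split_graph_del_6_colorable) _.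
rewrite ltnNge; apply: contra split_graph_not_6_colorable => chi_le6.
exact: edge_colorable_mono chi_le6 (chromatic_index_colorable _).
Qed.

Theorem proposition8 :
  exists (G : sgraph) (S : {set {set G}}) (u v : G),
    [/\ edges G != set0,
        mitigating S,
        #|S| = es_index G,
        [set u; v] \in S &
        maxn (deg u) (deg v) < max_deg G - 1].
Proof.
exists split_graph, [set split_edge], (inr true), (inr false).
split; rewrite ?inE //.
- by apply/set0Pn; exists split_edge; exact: split_edge_mem.
- exact: mitigating_split_edge.
- by rewrite cards1 (es_index_mitigating1 mitigating_split_edge).
have max_ge6 : 6 <= max_deg split_graph.
  rewrite -(deg_split (inl 0%R)).
  exact: (leq_bigmax (F := fun v : split_graph => deg v)).
by rewrite !deg_split; apply: leq_trans (leq_sub2r 1 max_ge6).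
Qed.
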